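(* Let $\alpha>1/\sqrt2$ be fixed. There is a constant $C$ depending only on $\alpha$ such that the following holds. Let $N\ge 2$ and $d\ge N-1$, and let $\mathcal{D}'$ be the distribution on $\mathbb{R}^{d+1}\times\{-1,+1\}$ defined in the context. Let $S_\infty$ be the $\ell_\infty$-perturbation set of radius $\epsilon=2\eta$ and $S_{\mathrm{RT}}$ the rotation-translation perturbation set with budget $N$. Then for every classifier $f:\mathbb{R}^{d+1}\to\{-1,+1\}$, $$\mathcal{R}^{\mathrm{avg}}_{\mathrm{adv}}(f;S_\infty,S_{\mathrm{RT}})\;\ge\;\tfrac12-\frac{C}{\sqrt N}.$$
   Context: The distribution $\mathcal{D}'$ over pairs $(\mathbf{x},y)$, $\mathbf{x}=(x_0,\dots,x_d)\in\mathbb{R}^{d+1}$: $y$ uniform on $\{-1,+1\}$; given $y$, $x_0\sim\mathcal{N}(y,\alpha^{-2})$ and $x_1,\dots,x_d$ i.i.d. $\mathcal{N}(y\eta,1)$, all independent, with $\eta=\alpha/\sqrt d$. The rotation-translation (RT) perturbation set with budget $M$ is $S_{\mathrm{RT}}(\mathbf{x})=\{\mathbf{x}_\pi:\pi$ a permutation of $\{0,\dots,d\}$ with $\pi(i)=i$ for all $i\ge M\}$, where $(\mathbf{x}_\pi)_i=x_{\pi(i)}$ (i.e. the coordinates with index $<M$ may be rearranged arbitrarily). The $\ell_p$-perturbation set of radius $\epsilon$ is $S(\mathbf{x})=\{\mathbf{x}+\mathbf{r}:\|\mathbf{r}\|_p\le\epsilon\}$. Adversarial risk: $\mathcal{R}_{\mathrm{adv}}(f;S)=\Pr_{(\mathbf{x},y)\sim\mathcal{D}'}[\exists\,\mathbf{x}'\in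 S(\mathbf{x}): f(\mathbf{x}')\neq y]$, and $\mathcal{R}^{\mathrm{avg}}_{\mathrm{adv}}(f;S_1,S_2)=\frac12(\mathcal{R}_{\mathrm{adv}}(f;S_1)+\mathcal{R}_{\mathrm{adv}}(f;S_2))$. *)

(* Defs.v *)
From HB Require Import structures.
From mathcomp Require Import all_boot all_order all_algebra all_fingroup.
From mathcomp Require Import all_classical all_reals all_analysis.
Set Implicit Arguments. Unset Strict Implicit. Unset Printing Implicit Defensive.
Import Order.TTheory GRing.Theory Num.Theory.
Import numFieldNormedType.Exports.
Local Open Scope classical_set_scope.
Local Open Scope ring_scope.

Section Defs.
Context {R : realType}.

Definition borel_rV (n : nat) (A : set 'rV[R]_n) : Prop :=
  <<s [set U : set 'rV[R]_n | open U] >> A.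

Definition classifier (n : nat) (f : 'rV[R]_n -> R) : Prop :=
  (forall x, f x = 1 \/ f x = -1) /\ borel_rV (f @^-1` [set 1]).

Definition linf_norm (n : nat) (r : 'rV[R]_n) : R := \big[Num.max/0]_(i < n) `|r 0 i|.

Definition S_linf (n : nat) (eps : R) (x : 'rV[R]_n) : set 'rV[R]_n :=
  [set x + r | r in [set r : 'rV[R]_n | linf_norm r <= eps]].

Definition permute_rV (n : nat) (x : 'rV[R]_n) (s : 'S_n) : 'rV[R]_n :=
  \row_i x 0 (s i).

Definition S_RT (n : nat) (M : nat) (x : 'rV[R]_n) : set 'rV[R]_n :=
  [set permute_rV x s | s in [set s : 'S_n | forall i : 'I_n, (M <= i)%N -> s i = i]].

Definition outer_prob {dO} {Omega : measurableType dO} (P : probability Omega R)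
  (A : set Omega) : \bar R :=
  ereal_inf [set P B | B in [set B : set Omega | measurable B /\ A `<=` B]].

(* The data distribution D' on R^{d+1} x {-1,+1}, realized by a label y and
   a feature vector X (coordinates x_0..x_d) on a probability space:
   y is uniform on {-1,+1}; given y, x_0 ~ N(y, alpha^-2) and
   x_1..x_d ~ N(y*eta,1) i.i.d., all independent, eta = alpha/sqrt d.
   The joint law is prescribed on all measurable boxes. *)
Definition Dprime_mean (d : nat) (alpha s : R) (i : 'I_d.+1) : R :=
  if (i == 0 :> nat) then s else s * (alpha / Num.sqrt d%:R).
Definition Dprime_sd (d : nat) (alpha : R) (i : 'I_d.+1) : R :=
  if (i == 0 :> nat) then alpha^-1 else 1.

Definition Dprime_model (d : nat) (alpha : R) {dO} {Omega : measurableType dO}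
  (P : probability Omega R) (y : Omega -> R) (X : Omega -> 'rV[R]_d.+1) : Prop :=
  [/\ measurable_fun setT y,
      (forall i, measurable_fun setT (fun w => X w 0 i)),
      (forall w, y w = 1 \/ y w = -1) &
      (forall s : R, s = 1 \/ s = -1 ->
       forall B : 'I_d.+1 -> set R, (forall i, measurable (B i)) ->
       P ([set w | y w = s] `&` \bigcap_i [set w | B i (X w 0 i)]) =
       ((2^-1)%:E * \prod_(i < d.+1) normal_prob (Dprime_mean alpha s i) (Dprime_sd alpha i) (B i))%E)].

Definition adv_risk {n : nat} {dO} {Omega : measurableType dO}
  (P : probability Omega R) (y : Omega -> R) (X : Omega -> 'rV[R]_n)
  (f : 'rV[R]_n -> R) (S : 'rV[R]_n -> set 'rV[R]_n) : \bar R :=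
  outer_prob P [set w | exists x', S (X w) x' /\ f x' <> y w].

Definition avg_adv_risk {n : nat} {dO} {Omega : measurableType dO}
  (P : probability Omega R) (y : Omega -> R) (X : Omega -> 'rV[R]_n)
  (f : 'rV[R]_n -> R) (S1 S2 : 'rV[R]_n -> set 'rV[R]_n) : \bar R :=
  ((2^-1)%:E * (adv_risk P y X f S1 + adv_risk P y X f S2))%E.

End Defs.

(* Main.v *)
Require Import Defs.
From HB Require Import structures.
From mathcomp Require Import all_boot all_order all_algebra all_fingroup.
From mathcomp Require Import all_classical all_reals all_analysis.
From mathcomp Require Import measurable_realfun ring lra.
Import Order.TTheory GRing.Theory Num.Theory.
Import numFieldNormedType.Exports.
Local Open Scope classical_set_scope.
Local Open Scope ring_scope.

(** Fix a label [s] and let [Q = N(s eta, 1)], [P1 = N(s, alpha^-2)],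
[P2 = N(-s, alpha^-2)].  Shifting the coordinates [1..d] by [2 s eta] is an
allowed [l_oo] perturbation; it turns the features of label [-s] into a sample
of [P2 x Q^d], while the features of label [s] follow [P1 x Q^d].  Let [E] be
the set of points some admissible permutation of which is not classified as
[s].  The permutation adversary wins on label [s] exactly on [E], and the shift
adversary wins on label [-s] at least on the complement of [E], so their
success probabilities add up to at least [1 + \int_E k(x_0) dQ^(d+1)], where
[k] is the difference of the densities of [P1] and [P2] with respect to [Q].
Since [E] is invariant under permutations of the first [N] coordinates, the
integral equals [N^-1 \int_E \sum_(i < N) k(x_i) dQ^(d+1)], a normalised sum
of independent centered variables, hence is [O(N^-1/2)].  The condition
[alpha > 1/sqrt 2] says precisely that [k] has finite variance. *)

Set Implicit Arguments. Unset Strict Implicit. Unset Printing Implicit Defensive.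

(** * Boxes and uniqueness of measures on tuples *)

Section tuple_boxes.
Local Open Scope ereal_scope.
Context d (T : measurableType d) (R : realType) (n : nat).

(** Samples are tuples rather than row vectors because tuples carry the product
sigma-algebra in the library. *)
Definition tuple_box (B : 'I_n -> set T) : set (n.-tuple T) :=
  [set t | forall i, B i (tnth t i)].

Lemma tuple_boxE B : tuple_box B = \big[setI/setT]_(i < n) ((@tnth _ T ^~ i) @^-1` B i).
Proof.
rewrite -bigcap_seq; apply/seteqP; split=> [t tB i _|t tB i]; first exact: tB.
exact: tB i (mem_index_enum i).
Qed.

Lemma measurable_tuple_box B : (forall i, measurable (B i)) ->
  measurable (tuple_box B).
Proof.
move=> mB; rewrite tuple_boxE; apply: bigsetI_measurable => i _.
rewrite -[X in measurable X]setTI; exact: measurable_tnth.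
Qed.

(** Boxes form a pi-system that contains the whole space and generates the product sigma-algebra, so
    two measures agreeing on them coincide as soon as the total mass is finite. *)
Lemma tuple_box_measure_unique (m1 m2 : {measure set (n.-tuple T) -> \bar R}) :
  (forall B, (forall i, measurable (B i)) -> m1 (tuple_box B) = m2 (tuple_box B)) ->
  m1 setT < +oo ->
  forall E, measurable E -> m1 E = m2 E.
Proof.
move=> m12 m1oo.
pose G := [set tuple_box B | B in [set B : 'I_n -> set T | forall i, measurable (B i)]].
have GT : G setT.
  by exists (fun=> setT) => //; apply/seteqP; split.
apply: (measure_unique G (fun=> setT)) => //.
- apply/seteqP; split; last first.
    apply: smallest_sub; first exact: sigma_algebra_measurable.
    by move=> _ [B mB <-]; exact: measurable_tuple_box.
  apply: sub_smallest2r; first exact: smallest_sigma_algebra.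
  rewrite -bigcup_seq => A [i _ [Y mY <-]].
  (* A cylinder over one coordinate is the box whose other sides are the whole space. *)
  exists (fun j => if j == i then Y else setT).
    by move=> j; case: ifP.
  rewrite setTI; apply/seteqP; split=> [t /(_ i)|t tY j]; first by rewrite eqxx.
  by case: eqVneq => // ->.
- move=> _ _ [A mA <-] [B mB <-]; exists (fun i => A i `&` B i).
    by move=> i; exact: measurableI.
  by apply/seteqP; split=> [t tAB|t [tA tB] i //]; split=> i; have [] := tAB i.
- by rewrite bigcup_const.
- by move=> _ [B mB <-]; exact: m12.
Qed.

End tuple_boxes.

(** * Measures of total mass one as bundled probabilities *)

Section probability_of_measure.
Local Open Scope ereal_scope.
Context d (T : measurableType d) (R : realType) (m : {measure set T -> \bar R}).
Hypothesis m1 : m setT = 1.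

(** A fresh name for [m], to which the probability structure can be attached. *)
Let total : set T -> \bar R := m.
HB.instance Definition _ := Measure.on total.
HB.instance Definition _ := Measure_isProbability.Build _ _ _ total m1.

Lemma measure_probability : exists P : probability T R, P = m :> (set T -> \bar R).
Proof. by exists total. Qed.

End probability_of_measure.

Lemma pushforward_probability d d' (T : measurableType d)
    (T' : measurableType d') (R : realType) (m : {measure set T -> \bar R})
    (f : T -> T') : measurable_fun setT f -> m setT = 1%E ->
  exists P : probability T' R, P = pushforward m f :> (set T' -> \bar R).
Proof.
move=> mf m1; pose m' : {measure set T' -> \bar R} := pushforward m f.
by apply: (@measure_probability _ _ _ (m' mf)).
Qed.

(** * Construction of independent identically distributed samples *)

Section iid.
Local Open Scope ereal_scope.
Context d (T : measurableType d) (R : realType).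
Implicit Types (n : nat) (Q : probability T R).

Definition tuple_cons n (z : T * n.-tuple T) : n.+1.-tuple T := [tuple of z.1 :: z.2].

Lemma measurable_tuple_cons n : measurable_fun setT (@tuple_cons n).
Proof. exact: measurable_cons. Qed.

Lemma tuple_cons_box n (B : 'I_n.+1 -> set T) :
  @tuple_cons n @^-1` tuple_box B =
  B ord0 `*` tuple_box (fun i => B (lift ord0 i)).
Proof.
apply/seteqP; split=> [[x t] /= xtB|[x t] /= [xB tB] i].
  by split=> [|i /=]; [exact: (xtB ord0)|rewrite -(tnthS x); exact: xtB].
by case: (unliftP ord0 i) => [j|] ->//=; rewrite /tuple_cons tnthS; exact: tB.
Qed.

Lemma cons_product_box n Q (nu : probability (n.-tuple T) R) B :
  (forall i, measurable (B i)) ->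
  (Q \x nu) (@tuple_cons n @^-1` tuple_box B) =
  Q (B ord0) * nu (tuple_box (fun i => B (lift ord0 i))).
Proof.
move=> mB; rewrite tuple_cons_box product_measure1E//.
exact: measurable_tuple_box.
Qed.

(** Stated for a bare set function, so that it applies directly to a pushforward before that is
    bundled as a probability. *)
Definition iid n Q (nu : set (n.-tuple T) -> \bar R) :=
  forall B, (forall i, measurable (B i)) ->
    nu (tuple_box B) = \prod_(i < n) Q (B i).

Lemma iid_cons n Q (nu : probability (n.-tuple T) R) : iid Q nu ->
  iid Q (pushforward (Q \x nu) (@tuple_cons n)).
Proof.
move=> iidnu B mB; rewrite /pushforward cons_product_box// iidnu//.
by rewrite big_ord_recl.
Qed.

(** Induction on the sample size: start from the Dirac mass at the empty tuple and prepend one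
    independent coordinate at a time. *)
Lemma iid_exists n Q : exists nu : probability (n.-tuple T) R, iid Q nu.
Proof.
elim: n => [|n [nu iidnu]].
  exists (dirac [tuple]) => B mB; rewrite big_ord0 /= diracE mem_set//.
  by case.
have /(pushforward_probability (@measurable_tuple_cons n))[nu' nu'E] :
    (Q \x nu) setT = 1.
  rewrite -setXTT product_measure1E// (probability_setT Q) mul1e.
  exact: probability_setT.
by exists nu'; rewrite nu'E; exact: iid_cons.
Qed.

End iid.

(** * Exchangeability and marginals of an iid sample *)

Section iid_theory.
Local Open Scope ereal_scope.
Context d (T : measurableType d) (R : realType) (n : nat).
Variables (Q : probability T R) (nu : probability (n.-tuple T) R).
Hypothesis iidnu : iid Q nu.

Definition tuple_perm (s : 'S_n) (t : n.-tuple T) : n.-tuple T :=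
  [tuple tnth t (s i) | i < n].

Lemma measurable_tuple_perm s : measurable_fun setT (tuple_perm s).
Proof.
apply/measurable_fun_tnthP => i.
rewrite (_ : _ \o _ = @tnth _ T ^~ (s i)); first exact: measurable_tnth.
by apply/funext => t /=; rewrite tnth_mktuple.
Qed.

(** On a box both sides are the same finite product up to reindexing by [s]; uniqueness on boxes
    does the rest. *)
Lemma iid_perm s E : measurable E -> nu (tuple_perm s @^-1` E) = nu E.
Proof.
apply: (@tuple_box_measure_unique _ _ _ _ (pushforward nu (tuple_perm s)) nu).
- exact: measurable_tuple_perm.
- move=> ms B mB; rewrite [LHS](_ : _ = nu (tuple_box (fun i => B ((s^-1)%g i)))).
    rewrite !iidnu// [LHS](reindex_inj (@perm_inj _ s))/=.
    by apply: eq_bigr => i _; rewrite permK.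
  congr (nu _); apply/seteqP; split=> t /= tB i.
    by have := tB ((s^-1)%g i); rewrite tnth_mktuple permKV.
  by rewrite tnth_mktuple; have := tB (s i); rewrite permK.
- by move=> ms; rewrite /= /pushforward preimage_setT probability_setT ltry.
Qed.

Lemma integral_iid_perm (s : 'S_n) (E : set (n.-tuple T)) (f : n.-tuple T -> \bar R) :
  measurable_fun [set: n.-tuple T] f -> measurable E -> tuple_perm s @^-1` E = E ->
  nu.-integrable E (f \o tuple_perm s) ->
  \int[nu]_(t in E) f (tuple_perm s t) = \int[nu]_(t in E) f t.
Proof.
move=> mf mE sE intf.
have intf' : nu.-integrable (tuple_perm s @^-1` E) (f \o tuple_perm s).
  by rewrite sE.
have := integral_pushforward (measurable_tuple_perm s) mf intf' mE.
rewrite sE => <-.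
apply: eq_measure_integral => [|ms A mA _]; first exact: measurable_tuple_perm.
exact: iid_perm.
Qed.

Lemma iid_tnth i B : measurable B -> nu [set t | B (tnth t i)] = Q B.
Proof.
move=> mB; pose C j := if j == i then B else setT.
have mC j : measurable (C j) by rewrite /C; case: ifP.
rewrite (_ : [set _ | _] = tuple_box C).
  rewrite iidnu// (bigD1 i)//= /C eqxx big1 ?mule1// => j /negbTE ->.
  exact: probability_setT.
apply/seteqP; split=> [t Bt j|t /(_ i)]; last by rewrite /C eqxx.
by rewrite /C; case: eqVneq => [->|].
Qed.

Lemma iid_tnth2 i j A B : i != j -> measurable A -> measurable B ->
  nu [set t | A (tnth t i) /\ B (tnth t j)] = Q A * Q B.
Proof.
move=> ij mA mB; pose C k := if k == i then A else if k == j then B else setT.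
have mC k : measurable (C k) by rewrite /C; case: ifP => //; case: ifP.
rewrite (_ : [set _ | _] = tuple_box C).
  rewrite iidnu// (bigD1 i)//= (bigD1 j) 1?eq_sym//= /C eqxx.
  rewrite (eq_sym j i) (negbTE ij) eqxx big1 ?mule1// => k /andP[/negbTE -> /negbTE ->].
  exact: probability_setT.
apply/seteqP; split=> [t [At Bt] k|t tC].
  by rewrite /C; case: eqVneq => [->|_] //; case: eqVneq => [->|].
by split; [have := tC i|have := tC j]; rewrite /C ?eqxx// eq_sym (negbTE ij).
Qed.

Lemma ge0_integral_iid_tnth i (h : T -> \bar R) :
  measurable_fun setT h -> (forall x, 0 <= h x) ->
  \int[nu]_t h (tnth t i) = \int[Q]_x h x.
Proof.
move=> mh h0.
have := ge0_integral_pushforward (measurable_tnth i) nu measurableT mh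
  (in1W h0).
rewrite preimage_setT => <-.
apply: eq_measure_integral => [|mi A mA _]; first exact: measurable_tnth.
exact: iid_tnth.
Qed.

Lemma integrable_iid_tnth i (h : T -> \bar R) :
  Q.-integrable setT h -> nu.-integrable setT (fun t => h (tnth t i)).
Proof.
move=> /integrableP[mh hoo]; apply/integrableP; split.
  by apply: measurableT_comp => //; exact: measurable_tnth.
rewrite (ge0_integral_iid_tnth i (h := abse \o h)) => [//||x].
  exact: measurableT_comp.
exact: abse_ge0.
Qed.

(** Two distinct coordinates have joint law [Q \x Q]. By Tonelli the absolute product integrates to
    the square of the first absolute moment, which is finite, and by Fubini the inner integral of
    the product is a multiple of the mean of [h], which is zero. *)
Lemma integral_iid_tnthM i j (h : T -> R) : i != j ->
  Q.-integrable setT (EFin \o h) -> \int[Q]_x (h x)%:E = 0 ->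
  nu.-integrable setT (fun t => (h (tnth t i) * h (tnth t j))%:E) /\
  \int[nu]_t (h (tnth t i) * h (tnth t j))%:E = 0.
Proof.
move=> ij inth h0; have /integrableP[mh hoo] := inth.
have /measurable_EFinP mhR := mh.
pose H (z : T * T) := (h z.1 * h z.2)%:E.
have mH : measurable_fun setT H.
  apply/measurable_EFinP; apply: measurable_funM.
    exact: measurableT_comp.
  exact: measurableT_comp.
have intH : (Q \x Q).-integrable setT H.
  apply/(integrable12ltyP _ _ mH).
  have mah : measurable_fun setT (fun x => `|h x|%:E).
    exact/measurable_EFinP/measurableT_comp.
  have HE x : \int[Q]_y `|H (x, y)| = `|h x|%:E * \int[Q]_y `|h y|%:E.
    rewrite -ge0_integralZl//.
    by apply: eq_integral => y _; rewrite /H/= normrM EFinM.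
  under eq_integral do rewrite HE.
  rewrite ge0_integralZr//; last exact: integral_ge0.
  have fint : \int[Q]_y `|h y|%:E \is a fin_num.
    by rewrite ge0_fin_numE// integral_ge0// => y _; rewrite lee_fin.
  by rewrite -(fineK fint) -EFinM ltry.
pose phi (t : n.-tuple T) := (tnth t i, tnth t j).
have mphi : measurable_fun setT phi.
  by apply: measurable_fun_pair; exact: measurable_tnth.
pose pm : {measure set (T * T) -> \bar R} := pushforward nu phi.
have nuphi A : measurable A -> (Q \x Q) A = pushforward nu phi A.
  apply: (product_measure_unique (m' := pm mphi)) => B C mB mC.
  exact: iid_tnth2.
have intHphi : nu.-integrable setT (H \o phi).
  apply/integrableP; split; first exact: measurableT_comp.
  have mHa : measurable_fun setT (abse \o H) by exact: measurableT_comp.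
  have H0 x : 0 <= (abse \o H) x by exact: abse_ge0.
  have := ge0_integral_pushforward mphi nu measurableT mHa (in1W H0).
  rewrite preimage_setT => <-.
  have /integrableP[_] := intH; apply: le_lt_trans.
  rewrite le_eqVlt; apply/orP; left; apply/eqP.
  by apply: eq_measure_integral => A mA _; exact/esym/nuphi.
split=> //.
have := integral_pushforward (D := setT) mphi mH intHphi measurableT.
rewrite preimage_setT => <-.
transitivity (\int[Q \x Q]_z H z).
  by apply: eq_measure_integral => A mA _; exact/esym/nuphi.
rewrite -integral12_prod_meas1// integral0_eq// => x _.
rewrite /fubini_F /H/=; under eq_integral do rewrite EFinM.
by rewrite integralZl// h0 mule0.
Qed.

End iid_theory.

(** * Centered functions integrated over symmetric events *)

Section symmetric_events.
Local Open Scope ereal_scope.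
Context d (T : measurableType d) (R : realType) (n N : nat).
Variables (Q : probability T R) (nu : probability (n.-tuple T) R).
Hypotheses (iidnu : iid Q nu) (N_gt0 : (0 < N)%N) (leNn : (N <= n)%N).
Variables (k : T -> R) (V : R).
Hypotheses (intk : Q.-integrable setT (EFin \o k)) (k0 : \int[Q]_x (k x)%:E = 0).
Hypotheses (intk2 : Q.-integrable setT (fun x => (k x ^+ 2)%:E)).
Hypothesis k2V : \int[Q]_x (k x ^+ 2)%:E <= V%:E.

Let w : 'I_N -> 'I_n := widen_ord leNn.
Let S (t : n.-tuple T) : R := (\sum_(i < N) k (tnth t (w i)))%R.
Let c (i j : 'I_N) (t : n.-tuple T) : \bar R :=
  (k (tnth t (w i)) * k (tnth t (w j)))%:E.

Let integrable_c i j : nu.-integrable setT (c i j).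
Proof.
have [->|ij] := eqVneq i j; last exact: (integral_iid_tnthM iidnu _ intk k0).1.
exact: (integrable_iid_tnth iidnu _ intk2).
Qed.

Let integral_c i j :
  \int[nu]_t c i j t = if i == j then \int[Q]_x (k x ^+ 2)%:E else 0.
Proof.
case: eqVneq => [->|ij]; last exact: (integral_iid_tnthM iidnu _ intk k0).2.
apply: (ge0_integral_iid_tnth iidnu (w j) (h := fun x => (k x ^+ 2)%:E)).
  exact: measurable_int intk2.
by move=> x; rewrite lee_fin sqr_ge0.
Qed.

Let SE t : (S t ^+ 2)%:E = \sum_(i < N) \sum_(j < N) c i j t.
Proof.
rewrite expr2 /S mulr_suml -sumEFin; apply: eq_bigr => i _.
by rewrite mulr_sumr -sumEFin.
Qed.

Let integrable_S2 : nu.-integrable setT (fun t => (S t ^+ 2)%:E).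
Proof.
rewrite (_ : (fun _ => _) = fun t => \sum_(i < N) \sum_(j < N) c i j t).
  apply: integrable_sum => //= i _; exact: integrable_sum.
by apply/funext => t; rewrite SE.
Qed.

(** Distinct coordinates are uncorrelated, so only the [N] diagonal terms of the squared sum
    survive. *)
Let integral_S2 : \int[nu]_t (S t ^+ 2)%:E <= (N%:R * V)%:E.
Proof.
under eq_integral do rewrite SE.
rewrite integral_sum//= => [|i]; last exact: integrable_sum.
rewrite (eq_bigr (fun=> \int[Q]_x (k x ^+ 2)%:E)) => [|i _]; last first.
  rewrite integral_sum//= (bigD1 i)//= big1 ?adde0 => [|j ji].
    by rewrite integral_c eqxx.
  by rewrite integral_c eq_sym (negbTE ji).
apply: (@le_trans _ _ (\sum_(i < N) V%:E)); first exact: lee_sum.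
by rewrite sumEFin sumr_const card_ord mulr_natl.
Qed.

Let integrable_k (i : 'I_n) : nu.-integrable setT (fun t => (k (tnth t i))%:E).
Proof. exact: (integrable_iid_tnth iidnu _ intk). Qed.

(** By symmetry of [E] the first [N] coordinates contribute equally, so [N] times the integral is
    the integral of [S] over [E]. This is at most the first absolute moment of [S], which the second
    moment bounds by [(V + 1) / 2] times the root of [N]. *)
Lemma integral_symmetric_event_le (E : set (n.-tuple T)) (i0 : 'I_n) :
  (i0 < N)%N -> measurable E ->
  (forall s : 'S_n, (forall i : 'I_n, (N <= i)%N -> s i = i) ->
    tuple_perm s @^-1` E = E) ->
  `|\int[nu]_(t in E) (k (tnth t i0))%:E| <=
    ((V + 1) / (2 * Num.sqrt N%:R))%:E.
Proof.
move=> i0N mE symE.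
have ES (i : 'I_N) : \int[nu]_(t in E) (k (tnth t (w i)))%:E =
    \int[nu]_(t in E) (k (tnth t i0))%:E.
  (* This transposition moves only indices below [N], hence is admissible and preserves [E]. *)
  have sE : tuple_perm (tperm (w i) i0) @^-1` E = E.
    apply: symE => j Nj; rewrite tpermD//; apply: contraTneq Nj => <-.
      by rewrite -ltnNge /=.
    by rewrite -ltnNge.
  have /measurable_EFinP mk := measurable_int _ intk.
  rewrite -(integral_iid_perm iidnu (f := fun t => (k (tnth t (w i)))%:E) _ mE sE).
  - by apply: eq_integral => t _; rewrite tnth_mktuple tpermL.
  - exact: measurable_int (integrable_k _).
  - rewrite (_ : _ \o _ = fun t => (k (tnth t i0))%:E).
      exact: integrableS (integrable_k i0).
    by apply/funext => t /=; rewrite tnth_mktuple tpermL.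
have intE (i : 'I_N) : nu.-integrable E (fun t => (k (tnth t (w i)))%:E).
  exact: integrableS (integrable_k (w i)).
have NI : \int[nu]_(t in E) (S t)%:E =
    N%:R%:E * \int[nu]_(t in E) (k (tnth t i0))%:E.
  under eq_integral do rewrite -sumEFin.
  rewrite integral_sum//= (eq_bigr _ (fun i _ => ES i)).
  have := integrable_fin_num mE (integrableS measurableT mE (@subsetT _ E) (integrable_k i0)).
  by move=> /fineK <-; rewrite sumEFin sumr_const card_ord -[X in X%:E]mulr_natl EFinM.
have sN0 : (0 < Num.sqrt (N%:R : R))%R by rewrite sqrtr_gt0 ltr0n.
have mS : measurable_fun setT S.
  apply: measurable_sum => i; apply/measurable_EFinP.
  exact: measurable_int (integrable_k (w i)).
have mSE : measurable_fun setT (fun t => (S t)%:E) by exact/measurable_EFinP.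
have mSa : measurable_fun setT (fun t => `|(S t)%:E|) by exact: measurableT_comp.
(* AM-GM: |S| <= S^2 / (2 sqrt N) + sqrt N / 2 *)
have SN : `|\int[nu]_(t in E) (S t)%:E| <=
    ((Num.sqrt N%:R)^-1 / 2 * (N%:R * V) + Num.sqrt N%:R / 2)%:E.
  apply: (@le_trans _ _ (\int[nu]_(t in E) `|(S t)%:E|)).
    apply: le_abse_integral => //.
    exact: measurable_funTS.
  apply: (@le_trans _ _ (\int[nu]_t `|(S t)%:E|)).
    apply: ge0_subset_integral => //.
  apply: (@le_trans _ _ (\int[nu]_t (((Num.sqrt N%:R)^-1 / 2)%:E * (S t ^+ 2)%:E +
      (Num.sqrt N%:R / 2)%:E))).
    apply: ge0_le_integral => //.
    - apply/measurable_EFinP; apply: measurable_funD => //.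
      by apply: measurable_funM => //; exact: measurable_funX.
    - move=> t _; rewrite -EFinM -EFinD lee_fin -(@ler_pM2r _ (2 * Num.sqrt N%:R)) ?mulr_gt0//.
      have -> : (((Num.sqrt N%:R)^-1 / 2 * S t ^+ 2 + Num.sqrt N%:R / 2) *
          (2 * Num.sqrt N%:R) = `|S t| ^+ 2 + (Num.sqrt (N%:R : R)) ^+ 2)%R.
        by rewrite real_normK ?num_real//; field; rewrite gt_eqF.
      by have := sqr_ge0 (`|S t| - Num.sqrt (N%:R : R)); nra.
  rewrite integralD//=; last 2 first.
  - exact: integrableZl.
  - exact: finite_measure_integrable_cst.
  rewrite integral_cst//= probability_setT mule1 EFinD leeD2r//.
  rewrite integralZl// [leRHS]EFinM lee_pmul2l//.
  by rewrite lte_fin mulr_gt0 ?invr_gt0.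
have N0 : (0 < N%:R :> R)%R by rewrite ltr0n.
rewrite -(@lee_pmul2l _ N%:R%:E)//.
have -> : N%:R%:E * `|\int[nu]_(t in E) (k (tnth t i0))%:E| =
    `|\int[nu]_(t in E) (S t)%:E|.
  by rewrite NI abseM/= ger0_norm// ltW.
apply: (le_trans SN); rewrite -EFinM lee_fin.
rewrite le_eqVlt; apply/orP; left; apply/eqP.
rewrite -[X in (X * V)%R]sqr_sqrtr ?ler0n// -[X in _ = (X * _)%R]sqr_sqrtr ?ler0n//.
by field; rewrite gt_eqF.
Qed.

End symmetric_events.

(** * Densities with respect to a reference measure *)

Section density.
Local Open Scope ereal_scope.
Context d (T : measurableType d) (R : realType).

(** [g] agrees almost everywhere with the Radon-Nikodym derivative of [P], since both have the same
    integrals over measurable sets; the change of variables for the derivative then transfers to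
    [g]. *)
Lemma ge0_integral_density (P : {finite_measure set T -> \bar R})
    (mu : {sigma_finite_measure set T -> \bar R}) (g : T -> R) (f : T -> \bar R) :
  measurable_fun setT g -> (forall x, (0 <= g x)%R) ->
  (forall A, measurable A -> P A = \int[mu]_(x in A) (g x)%:E) ->
  measurable_fun setT f -> (forall x, 0 <= f x) ->
  \int[P]_x f x = \int[mu]_x (f x * (g x)%:E).
Proof.
move=> mg g0 PE mf f0.
have mgE : measurable_fun setT (fun x => (g x)%:E) by exact/measurable_EFinP.
have Pmu : P `<< mu.
  apply/null_content_dominatesP => A mA muA0; rewrite PE//.
  by apply: null_set_integral => //; exact: measurable_funTS.
rewrite -(Radon_Nikodym_SigmaFinite.change_of_variables Pmu f0 measurableT mf).
have mrn := measurable_int _ (Radon_Nikodym_SigmaFinite.f_integrable Pmu).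
apply: ae_eq_integral => //.
- exact: emeasurable_funM.
- exact: emeasurable_funM.
- apply: (@ae_eqe_mul2l _ _ _ _ _ (Radon_Nikodym_SigmaFinite.f P mu)
    (fun x => (g x)%:E) f).
  apply: integral_ae_eq => //.
    exact: (Radon_Nikodym_SigmaFinite.f_integrable Pmu).
  by move=> A _ mA; rewrite -PE// (Radon_Nikodym_SigmaFinite.f_integral Pmu).
Qed.

Context d' (T' : measurableType d').

(** Tonelli: slice [E] over the first factor and pull the density, constant on each slice, out of
    the inner integral. *)
Lemma product_density (P Q : probability T R) (nu : probability T' R)
    (g : T -> R) (E : set (T * T')) :
  measurable_fun setT g -> (forall x, (0 <= g x)%R) ->
  (forall A, measurable A -> P A = \int[Q]_(x in A) (g x)%:E) ->
  measurable E ->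
  (P \x nu) E = \int[Q \x nu]_(z in E) (g z.1)%:E.
Proof.
move=> mg g0 PE mE.
have mnuE := measurable_fun_xsection nu mE.
have mgE : measurable_fun setT (fun x => (g x)%:E) by exact/measurable_EFinP.
have mg1 : measurable_fun setT (fun z : T * T' => (g z.1)%:E).
  by apply/measurable_EFinP; exact: measurableT_comp.
rewrite {1}/product_measure1 (ge0_integral_density mg g0 PE)//.
rewrite [RHS]integral_mkcond/= fubini_tonelli1.
- apply: eq_integral => x _; rewrite /fubini_F.
  have gE y : ((fun z : T * T' => (g z.1)%:E) \_ E) (x, y) =
      (g x)%:E * (\1_(xsection E x) y)%:E.
    rewrite patchE indicE mem_xsection.
    by case: ifP => _; rewrite ?mule1 ?mule0.
  under [RHS]eq_integral do rewrite gE.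
  have mxE : measurable (xsection E x) by exact: measurable_xsection.
  rewrite ge0_integralZl ?lee_fin//; last first.
    by apply/measurable_EFinP; exact: measurable_indic.
  by rewrite integral_indic ?setIT 1?muleC.
- exact/(measurable_restrictT _ mE)/measurable_funTS.
- by move=> z; rewrite patchE; case: ifP => // _; rewrite lee_fin.
Qed.
End density.

(** * Testing two first-coordinate laws with a symmetric event *)

Section symmetric_test.
Local Open Scope ereal_scope.
Context d (T : measurableType d) (R : realType) (n : nat).
Variables (Q : probability T R) (nu : probability (n.-tuple T) R).
Hypothesis iidnu : iid Q nu.

Lemma cons_density (P : probability T R) (g : T -> R)
    (nu1 : probability (n.+1.-tuple T) R) (E : set (n.+1.-tuple T)) :
  nu1 = pushforward (Q \x nu) (@tuple_cons _ T n) :> (set _ -> \bar R) ->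
  measurable_fun setT g -> (forall x, (0 <= g x)%R) ->
  (forall A, measurable A -> P A = \int[Q]_(x in A) (g x)%:E) ->
  measurable E ->
  (P \x nu) (@tuple_cons _ T n @^-1` E) = \int[nu1]_(t in E) (g (tnth t ord0))%:E.
Proof.
move=> nu1E mg g0 PE mE.
have mcons := @measurable_tuple_cons _ T n.
rewrite (product_density nu mg g0 PE); last first.
  by rewrite -[X in measurable X]setTI; exact: mcons.
have mf : measurable_fun E (fun t : n.+1.-tuple T => (g (tnth t ord0))%:E).
  apply: measurable_funTS; apply/measurable_EFinP.
  by apply: measurableT_comp => //; exact: measurable_tnth.
have f0 : {in E, forall t, 0 <= (g (tnth t ord0))%:E}.
  by move=> t _; rewrite lee_fin.
have := ge0_integral_pushforward mcons (Q \x nu) mE mf f0.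
rewrite [X in _ = X -> _](_ : _ =
    \int[Q \x nu]_(z in @tuple_cons _ T n @^-1` E) (g z.1)%:E); last first.
  by apply: eq_integral.
move=> <-; apply: eq_measure_integral => A mA _ /=.
by rewrite nu1E.
Qed.

Variables (N : nat) (V : R) (P1 P2 : probability T R) (g1 g2 : T -> R).
Hypotheses (N_gt0 : (0 < N)%N) (leNn : (N <= n.+1)%N).
Hypotheses (mg1 : measurable_fun setT g1) (mg2 : measurable_fun setT g2).
Hypotheses (g1_ge0 : forall x, (0 <= g1 x)%R) (g2_ge0 : forall x, (0 <= g2 x)%R).
Hypothesis P1E : forall A, measurable A -> P1 A = \int[Q]_(x in A) (g1 x)%:E.
Hypothesis P2E : forall A, measurable A -> P2 A = \int[Q]_(x in A) (g2 x)%:E.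
Hypothesis g1V : \int[Q]_x (g1 x ^+ 2)%:E <= V%:E.
Hypothesis g2V : \int[Q]_x (g2 x ^+ 2)%:E <= V%:E.

Lemma integrable_density (P : probability T R) (g : T -> R) :
  measurable_fun setT g -> (forall x, (0 <= g x)%R) ->
  (forall A, measurable A -> P A = \int[Q]_(x in A) (g x)%:E) ->
  Q.-integrable setT (EFin \o g).
Proof.
move=> mg g0 PE; apply/integrableP; split; first exact/measurable_EFinP.
under eq_integral do rewrite /= ger0_norm//.
by rewrite -PE// probability_setT ltry.
Qed.

(** The right-hand side is one plus the difference of the two probabilities of [E], that is, one
    plus the integral over [E] of [g1 - g2] at coordinate zero. This difference is centered because
    both densities have mass one, so the bound for symmetric events applies with [V + V]. *)
Lemma symmetric_test (E : set (n.+1.-tuple T)) : measurable E ->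
  (forall s : 'S_n.+1, (forall i : 'I_n.+1, (N <= i)%N -> s i = i) ->
    tuple_perm s @^-1` E = E) ->
  (1 - (V + V + 1) / (2 * Num.sqrt N%:R))%:E <=
    (P1 \x nu) (@tuple_cons _ T n @^-1` E) +
    (P2 \x nu) (@tuple_cons _ T n @^-1` (~` E)).
Proof.
move=> mE symE.
have mcons := @measurable_tuple_cons _ T n.
have /(pushforward_probability mcons)[nu1 nu1E] : (Q \x nu) setT = 1.
  rewrite -setXTT product_measure1E// (probability_setT Q) mul1e.
  exact: probability_setT.
have iidnu1 : iid Q nu1 by rewrite nu1E; exact: iid_cons.
have mE' : measurable (@tuple_cons _ T n @^-1` E).
  by rewrite -[X in measurable X]setTI; exact: mcons.
have intg1 := integrable_density mg1 g1_ge0 P1E.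
have intg2 := integrable_density mg2 g2_ge0 P2E.
pose k x := (g1 x - g2 x)%R.
have intk : Q.-integrable setT (EFin \o k).
  by apply: eq_integrable (integrableB measurableT intg1 intg2).
have k0 : \int[Q]_x (k x)%:E = 0.
  under eq_integral do rewrite EFinB.
  rewrite integralB_EFin//.
  by rewrite -P1E// -P2E// !probability_setT subee.
have mg12 : measurable_fun setT (fun x => (g1 x ^+ 2)%:E).
  by apply/measurable_EFinP; exact: measurable_funX.
have mg22 : measurable_fun setT (fun x => (g2 x ^+ 2)%:E).
  by apply/measurable_EFinP; exact: measurable_funX.
have mk2 : measurable_fun setT (fun x => (k x ^+ 2)%:E).
  by apply/measurable_EFinP; apply: measurable_funX; exact: measurable_funB.
have k2V : \int[Q]_x (k x ^+ 2)%:E <= (V + V)%:E.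
  apply: (@le_trans _ _ (\int[Q]_x ((g1 x ^+ 2)%:E + (g2 x ^+ 2)%:E))).
    apply: ge0_le_integral => //.
    - by move=> x _; rewrite lee_fin sqr_ge0.
    - exact: emeasurable_funD.
    - move=> x _; rewrite -EFinD lee_fin /k.
      (* The cross term of the square is nonpositive because both densities are nonnegative. *)
      by have := g1_ge0 x; have := g2_ge0 x; nra.
  rewrite ge0_integralD//; first by rewrite EFinD leeD.
  - by move=> x _; rewrite lee_fin sqr_ge0.
  - by move=> x _; rewrite lee_fin sqr_ge0.
have intk2 : Q.-integrable setT (fun x => (k x ^+ 2)%:E).
  apply/integrableP; split => //.
  under eq_integral do rewrite /= ger0_norm ?sqr_ge0//.
  exact: le_lt_trans k2V (ltry _).
have := integral_symmetric_event_le iidnu1 N_gt0 leNn intk k0 intk2 k2V (i0 := ord0) N_gt0 mE symE.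
have -> : \int[nu1]_(t in E) (k (tnth t ord0))%:E =
    (P1 \x nu) (@tuple_cons _ T n @^-1` E) - (P2 \x nu) (@tuple_cons _ T n @^-1` E).
  rewrite (cons_density nu1E mg1 g1_ge0 P1E mE) (cons_density nu1E mg2 g2_ge0 P2E mE).
  under eq_integral do rewrite EFinB.
  rewrite integralB_EFin//.
  - exact: integrableS (integrable_iid_tnth iidnu1 _ intg1).
  - exact: integrableS (integrable_iid_tnth iidnu1 _ intg2).
(* Besides the complement rule, this records finiteness, which lets the last inequality be settled
   in the reals. *)
have cons_setC (P : probability T R) :
    (P \x nu) (~` (@tuple_cons _ T n @^-1` E)) =
    1 - (P \x nu) (@tuple_cons _ T n @^-1` E) /\
    (P \x nu) (@tuple_cons _ T n @^-1` E) \is a fin_num.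
  have /measure_probability[P' P'E] : (P \x nu) setT = 1.
    rewrite -setXTT product_measure1E// (probability_setT P) mul1e.
    exact: probability_setT.
  by rewrite -P'E probability_setC//; split => //; exact: fin_num_measure.
have [_ fin1] := cons_setC P1; have [P2C fin2] := cons_setC P2.
rewrite preimage_setC P2C -(fineK fin1) -(fineK fin2).
rewrite -!EFinB -EFinD !lee_fin ler_norml => /andP[+ _].
by rewrite lerNl lerBlDr => ?; lra.
Qed.

End symmetric_test.

(** * Translations and density ratios of normal laws *)

Section gaussian.
Context (R : realType).
Local Notation mu := (@lebesgue_measure R).
Implicit Types m s c : R.

(** The translated measure gives half-open intervals their length, which characterizes Lebesgue
    measure. *)
Lemma lebesgue_measure_shift c (A : set R) : measurable A ->
  mu ((fun x => x + c) @^-1` A) = mu A.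
Proof.
move=> mA.
have mshift : measurable_fun [set: R] (fun x : R => x + c).
  exact: measurable_funD.
pose shift (x : measurableTypeR R) : measurableTypeR R := x + c.
pose pm : {measure set (measurableTypeR R) -> \bar R} := pushforward mu shift.
apply/esym; apply: (@lebesgue_measure_unique R (pm mshift)) => // _ [[a b] /= _ <-].
rewrite /pushforward lebesgue_measure_itv /=.
rewrite [X in mu X](_ : _ = `]a - c, b - c]%classic); last first.
  by apply/seteqP; split=> x /=; rewrite !in_itv/= ltrBlDr lerBrDr.
rewrite lebesgue_measure_itv/= !lte_fin ltrD2r.
by case: ifP => // _; rewrite -!EFinB; congr (_%:E); ring.
Qed.

Lemma normal_prob_shift m s c (A : set R) : s != 0 -> measurable A ->
  normal_prob m s ((fun x => x + c) @^-1` A) = normal_prob (m + c) s A.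
Proof.
move=> s0 mA; rewrite /normal_prob.
pose shift (x : measurableTypeR R) : measurableTypeR R := x + c.
have mshift : measurable_fun setT shift by exact: measurable_funD.
have mf : measurable_fun (A : set (measurableTypeR R))
    (fun x : measurableTypeR R => (normal_pdf (m + c) s x)%:E).
  by apply: measurable_funTS; apply/measurable_EFinP; exact: measurable_normal_pdf.
have f0 : {in A, forall x, (0 <= (normal_pdf (m + c) s x)%:E)%E}.
  by move=> x _; rewrite lee_fin normal_pdf_ge0.
have := ge0_integral_pushforward mshift mu mA mf f0.
rewrite [X in _ = X -> _](_ : _ =
    \int[mu]_(x in (fun x => (x + c)%R) @^-1` A) (normal_pdf m s x)%:E)%E; last first.
  apply: eq_integral => x _ /=; rewrite !normal_pdfE// /normal_fun.
  by rewrite /shift opprD addrACA subrr addr0.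
by move=> <-; apply: eq_measure_integral => B mB _; exact: lebesgue_measure_shift.
Qed.

Variables (m s m' s' : R).
Hypothesis s'0 : s' != 0.

(** The second factor is the reciprocal of [normal_pdf m' s' x], spelled out so
that measurability is immediate. *)
Definition normal_ratio (x : R) :=
  normal_pdf m s x *
  ((normal_peak s')^-1 * expR ((x - m') ^+ 2 / (s' ^+ 2 *+ 2))).

Lemma normal_ratioK x : normal_ratio x * normal_pdf m' s' x = normal_pdf m s x.
Proof.
rewrite /normal_ratio [in X in _ * X = _]normal_pdfE// /normal_fun mulNr expRN.
by field; rewrite !gt_eqF ?expR_gt0 ?normal_peak_gt0.
Qed.

Lemma measurable_normal_ratio : measurable_fun setT normal_ratio.
Proof.
apply: measurable_funM; first exact: measurable_normal_pdf.
apply: measurable_funM => //; apply: measurableT_comp => //.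
apply: measurable_funM => //; apply: measurable_funX.
exact: measurable_funB.
Qed.

Lemma normal_ratio_ge0 x : 0 <= normal_ratio x.
Proof.
by rewrite !mulr_ge0 ?normal_pdf_ge0 ?expR_ge0// invr_ge0 normal_peak_ge0.
Qed.

Lemma ge0_integral_normal_prob (f : R -> \bar R) :
  measurable_fun setT f -> (forall x, 0 <= f x)%E ->
  (\int[normal_prob m' s']_x f x = \int[mu]_x (f x * (normal_pdf m' s' x)%:E))%E.
Proof.
move=> mf f0.
have E := @ge0_integral_density _ _ _ (normal_prob m' s') mu (normal_pdf m' s') f.
apply: E => //; first exact: measurable_normal_pdf.
by move=> x; exact: normal_pdf_ge0.
Qed.

Lemma normal_prob_density (A : set R) : measurable A ->
  (normal_prob m s A = \int[normal_prob m' s']_(x in A) (normal_ratio x)%:E)%E.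
Proof.
move=> mA.
have mr : measurable_fun setT (fun x => (normal_ratio x)%:E).
  by apply/measurable_EFinP; exact: measurable_normal_ratio.
rewrite [RHS]integral_mkcond/= ge0_integral_normal_prob.
- rewrite /normal_prob integral_mkcond; apply: eq_integral => x _.
  rewrite !patchE; case: ifP => _; last by rewrite mul0e.
  by rewrite -EFinM normal_ratioK.
- exact/(measurable_restrictT _ mA)/measurable_funTS.
- by move=> x; rewrite patchE; case: ifP => // _; rewrite lee_fin normal_ratio_ge0.
Qed.

(** Against the reference density one factor of the squared ratio turns into the numerator density.
    If the resulting integrand is below [V] times some normal density, integrating the latter gives
    [V]. *)
Lemma integral_normal_ratio2_le (V : R) s0' m0 : 0 <= V ->
  (forall x, normal_ratio x * normal_pdf m s x <= V * normal_pdf m0 s0' x) ->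
  (\int[normal_prob m' s']_x (normal_ratio x ^+ 2)%:E <= V%:E)%E.
Proof.
move=> V0 VP; rewrite ge0_integral_normal_prob.
- rewrite -[leRHS]mule1 -(integral_normal_pdf m0 s0') -ge0_integralZl//.
  + apply: ge0_le_integral => //.
    * by move=> x _; rewrite -EFinM lee_fin mulr_ge0 ?sqr_ge0 ?normal_pdf_ge0.
    * apply/measurable_EFinP; apply: measurable_funM.
        by apply: measurable_funX; exact: measurable_normal_ratio.
      exact: measurable_normal_pdf.
    * apply/measurable_EFinP; apply: measurable_funM => //.
      exact: measurable_normal_pdf.
    * move=> x _; rewrite -!EFinM lee_fin expr2 -mulrA normal_ratioK; exact: VP.
  + by apply/measurable_EFinP; exact: measurable_normal_pdf.
  + by move=> x _; rewrite lee_fin normal_pdf_ge0.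
- by apply/measurable_EFinP; apply: measurable_funX; exact: measurable_normal_ratio.
- by move=> x; rewrite lee_fin sqr_ge0.
Qed.

End gaussian.

(** The integrand is a constant times the exponential of a quadratic with leading coefficient
    [- (alpha ^+ 2 - 2^-1)], negative by hypothesis. The bound is uniform in both means, so it
    depends on [alpha] alone. *)
Lemma normal_ratio2_bound (R : realType) (alpha : R) : (Num.sqrt 2)^-1 < alpha ->
  exists V : R, forall m m' : R, `|m| = 1 -> `|m'| <= alpha ->
    (\int[normal_prob m' 1]_x (normal_ratio m alpha^-1 m' 1 x ^+ 2)%:E <= V%:E)%E.
Proof.
move=> ha.
have s2 : 0 < Num.sqrt 2 :> R by rewrite sqrtr_gt0.
have a0 : 0 < alpha by apply: lt_trans ha; rewrite invr_gt0.
have b0 : 0 < alpha ^+ 2 - 2^-1.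
  rewrite subr_gt0 -[X in X^-1](@sqr_sqrtr _ 2)// -exprVn.
  by rewrite ltr_pXn2r// nnegrE ltW// invr_gt0.
set b := alpha ^+ 2 - 2^-1 in b0.
(* Half of the decay [- b * x ^+ 2] is kept as a centered normal density of deviation [s0]; the
   other half absorbs the linear term. *)
pose s0 := (Num.sqrt b)^-1.
have s00 : s0 != 0 by rewrite gt_eqF// invr_gt0 sqrtr_gt0.
have ai0 : alpha^-1 != 0 by rewrite gt_eqF// invr_gt0.
(* The first summand bounds [q ^+ 2 / (2 * b)] from completing the square, the second bounds
   [m' ^+ 2 / 2]. *)
pose c := (2 * alpha ^+ 2 + alpha) ^+ 2 / (2 * b) + alpha ^+ 2 / 2.
exists (normal_peak alpha^-1 ^+ 2 / normal_peak 1 / normal_peak s0 * expR c).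
move=> m m' m1 m'a.
apply: (@integral_normal_ratio2_le _ _ _ _ _ (oner_neq0 R) _ s0 0).
  by rewrite !mulr_ge0 ?expR_ge0// ?invr_ge0 ?normal_peak_ge0 ?sqr_ge0.
move=> x; rewrite /normal_ratio !normal_pdfE//.
rewrite /normal_fun expr1n subr0.
have -> : - (x - m) ^+ 2 / (alpha^-1 ^+ 2 *+ 2) = - alpha ^+ 2 * (x - m) ^+ 2 / 2.
  by rewrite -mulr_natr; field; rewrite gt_eqF.
have -> : - x ^+ 2 / (s0 ^+ 2 *+ 2) = - b * x ^+ 2 / 2.
  rewrite /s0 exprVn sqr_sqrtr ?(ltW b0)//.
  by rewrite -mulr_natr; field; rewrite gt_eqF.
have p1 : 0 < normal_peak (1 : R) by rewrite normal_peak_gt0 ?oner_neq0.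
have p0 : 0 < normal_peak s0 by rewrite normal_peak_gt0.
have -> : normal_peak alpha^-1 ^+ 2 / normal_peak 1 / normal_peak s0 * expR c *
    (normal_peak s0 * expR (- b * x ^+ 2 / 2)) =
    normal_peak alpha^-1 ^+ 2 / normal_peak 1 * expR (c - b * x ^+ 2 / 2).
  rewrite !mulNr (expRD c); set e := expR c.
  by field; rewrite !gt_eqF.
have -> : normal_peak alpha^-1 * expR (- alpha ^+ 2 * (x - m) ^+ 2 / 2) *
    ((normal_peak 1)^-1 * expR ((x - m') ^+ 2 / (1 *+ 2))) *
    (normal_peak alpha^-1 * expR (- alpha ^+ 2 * (x - m) ^+ 2 / 2)) =
    normal_peak alpha^-1 ^+ 2 / normal_peak 1 *
    expR ((x - m') ^+ 2 / 2 - alpha ^+ 2 * (x - m) ^+ 2).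
  have -> : (x - m') ^+ 2 / 2 - alpha ^+ 2 * (x - m) ^+ 2 = (x - m') ^+ 2 / 2 +
      (- alpha ^+ 2 * (x - m) ^+ 2 / 2 + - alpha ^+ 2 * (x - m) ^+ 2 / 2) by field.
  by rewrite !(expRD ((x - m') ^+ 2 / 2)) !(expRD (_ / 2)); field; rewrite gt_eqF.
apply: ler_wpM2l; first by apply: mulr_ge0; [exact: sqr_ge0|rewrite invr_ge0 ltW].
rewrite ler_expR.
have m2 : m ^+ 2 = 1 by rewrite -real_normK ?num_real// m1 expr1n.
(* The coefficient of [x] in the exponent. *)
pose q := 2 * alpha ^+ 2 * m - m'.
have q2 : q ^+ 2 <= (2 * alpha ^+ 2 + alpha) ^+ 2.
  rewrite -[q ^+ 2]real_normK ?num_real// lerXn2r// ?nnegrE ?addr_ge0 ?mulr_ge0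
    ?sqr_ge0 ?(ltW a0)//.
  apply: (le_trans (ler_normB _ _)); apply: lerD => //.
  by rewrite normrM m1 mulr1 ger0_norm// mulr_ge0 ?sqr_ge0.
have m'2 : m' ^+ 2 <= alpha ^+ 2.
  by rewrite -[m' ^+ 2]real_normK ?num_real// lerXn2r// ?nnegrE ?(ltW a0).
(* Young: q x <= b x^2 / 2 + q^2 / (2 b) *)
have young : q * x <= b * x ^+ 2 / 2 + q ^+ 2 / (2 * b).
  have -> : b * x ^+ 2 / 2 + q ^+ 2 / (2 * b) = q * x + (b * x - q) ^+ 2 / (2 * b).
    by field; rewrite gt_eqF.
  by rewrite lerDl divr_ge0 ?sqr_ge0// mulr_ge0 ?ltW.
have q2b : q ^+ 2 / (2 * b) <= (2 * alpha ^+ 2 + alpha) ^+ 2 / (2 * b).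
  by rewrite ler_pM2r// invr_gt0 mulr_gt0.
have -> : (x - m') ^+ 2 / 2 - alpha ^+ 2 * (x - m) ^+ 2 =
    - b * x ^+ 2 + q * x - alpha ^+ 2 * m ^+ 2 + m' ^+ 2 / 2.
  by rewrite /b /q; field.
rewrite m2 mulr1.
have := sqr_ge0 alpha; rewrite /c; nra.
Qed.

(** * Measurability of Borel preimages under coordinatewise measurable maps *)

Section borel_rV_preimage.
Context (R : realType) (n : nat) dO (Omega : measurableType dO).
Variable X : Omega -> 'rV[R]_n.
Hypothesis mX : forall i, measurable_fun setT (fun w => X w 0 i).

(** Rational endpoints make the family of boxes countable. *)
Let box (ab : 'rV[rat]_n * 'rV[rat]_n) : set 'rV[R]_n :=
  [set x | forall i, ratr (ab.1 0 i) < x 0 i < ratr (ab.2 0 i)].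

Let measurable_preimage_box ab : measurable (X @^-1` box ab).
Proof.
rewrite (_ : _ @^-1` _ = \big[setI/setT]_(i < n)
    ((fun w => X w 0 i) @^-1` `]ratr (ab.1 0 i), ratr (ab.2 0 i)[)).
  apply: bigsetI_measurable => i _; rewrite -[X in measurable X]setTI.
  exact: mX.
rewrite -bigcap_seq; apply/seteqP; split=> [w Xw i _|w Xw i].
  by rewrite /= in_itv; exact: Xw.
by have := Xw i (mem_index_enum i); rewrite /= in_itv.
Qed.

Let open_box (U : set 'rV[R]_n) : open U ->
  U = \bigcup_(ab in [set ab | box ab `<=` U]) box ab.
Proof.
move=> oU; apply/seteqP; split=> [x Ux|x [ab abU abx]]; last exact: abU.
have /nbhs_ballP[e e0 eU] : nbhs x U by rewrite openE in oU; exact: oU.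
have /= xl i : exists q : rat, x 0 i - e < ratr q < x 0 i.
  have /rat_in_itvoo[q] : x 0 i - e < x 0 i by rewrite ltrBlDr ltrDl.
  by rewrite in_itv /=; exists q.
have /= xr i : exists q : rat, x 0 i < ratr q < x 0 i + e.
  have /rat_in_itvoo[q] : x 0 i < x 0 i + e by rewrite ltrDl.
  by rewrite in_itv /=; exists q.
have [a aP] := choice xl; have [b bP] := choice xr.
exists (\row_i a i, \row_i b i) => /=.
  move=> y /= yab; apply: eU; split=> // i j; rewrite ord1.
  have := yab j; rewrite !mxE => /andP[ay yb].
  have /andP[xa _] := aP j; have /andP[_ bx] := bP j.
  by rewrite /ball/= ltr_distlC (lt_trans xa ay) (lt_trans yb bx).
by move=> i; rewrite !mxE; have /andP[_ ->] := aP i; have /andP[-> _] := bP i.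
Qed.

(** The sets with measurable preimage form a sigma-algebra, and it contains every open set, a
    countable union of rational boxes. *)
Lemma measurable_borel_preimage (E : set 'rV[R]_n) : borel_rV E ->
  measurable (X @^-1` E).
Proof.
pose F := [set A : set 'rV[R]_n | measurable (X @^-1` A)].
suff : <<s [set U : set 'rV[R]_n | open U] >> `<=` F by exact.
apply: smallest_sub; first split.
- by rewrite /F/= preimage_set0.
- by move=> A FA; rewrite /F/= setTD preimage_setC; exact: measurableC.
- by move=> A FA; rewrite /F/= preimage_bigcup; exact: bigcupT_measurable.
move=> U oU; rewrite /F/= (open_box oU) preimage_bigcup.
rewrite bigcup_mkcond; apply: countable_bigcupT_measurable; first exact: countableP.
by move=> ab; case: ifP.
Qed.

End borel_rV_preimage.

(** * Lower bounds on outer probability and laws restricted to an event *)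

Lemma outer_prob_ge (R : realType) dO (Omega : measurableType dO)
    (P : probability Omega R) (A B : set Omega) :
  measurable B -> B `<=` A -> (P B <= outer_prob P A)%E.
Proof.
move=> mB BA; apply: le_ereal_inf_tmp => _ [D [mD AD] <-].
by apply: le_measure; rewrite ?inE//; exact: subset_trans AD.
Qed.

(** Passes from boxes to all measurable sets. [A] will be a label event and [r] its probability one
    half, so no conditional law has to be formed. *)
Lemma cons_law d (T : measurableType d) (R : realType) n (P0 Q : probability T R)
    (nu : probability (n.-tuple T) R) dO (Omega : measurableType dO)
    (P : probability Omega R) (A : set Omega) (Z : Omega -> n.+1.-tuple T)
    (r : {nonneg R}) :
  iid Q nu -> measurable A -> measurable_fun setT Z ->
  (forall B, (forall i, measurable (B i)) -> P (A `&` Z @^-1` tuple_box B) =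
    (r%:num%:E * (P0 (B ord0) * \prod_(i < n) Q (B (lift ord0 i))))%E) ->
  forall E, measurable E ->
  P (A `&` Z @^-1` E) = (r%:num%:E * (P0 \x nu) (@tuple_cons _ T n @^-1` E))%E.
Proof.
move=> iidnu mA mZ law E mE.
pose m1 : {measure set _ -> \bar R} := pushforward (mrestr P mA) Z.
pose m2 : {measure set _ -> \bar R} := pushforward (P0 \x nu)%E (@tuple_cons _ T n).
pose m3 : {measure set _ -> \bar R} := mscale r (m2 (@measurable_tuple_cons _ T n)).
rewrite setIC; apply: (@tuple_box_measure_unique _ _ _ _ (m1 mZ) m3) => //.
  move=> B mB.
  have -> : m1 mZ (tuple_box B) = P (A `&` Z @^-1` tuple_box B) by rewrite setIC.
  rewrite law//; congr (_ * _)%E.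
  by rewrite -iidnu// -cons_product_box.
rewrite /= /pushforward preimage_setT /mrestr setTI.
by rewrite (le_lt_trans (probability_le1 _ _)) ?ltry.
Qed.

(** * Laws of the features under each label *)

Section model.
Context (R : realType) (d : nat) (alpha : R) (dO : measure_display).
Context (Omega : measurableType dO) (P : probability Omega R).
Context (y : Omega -> R) (X : Omega -> 'rV[R]_d.+1).
Hypotheses (alpha_gt0 : 0 < alpha) (XP : Dprime_model alpha P y X).

(** Shift 0 gives the features themselves as a tuple; a nonzero shift is the translation attack,
    which leaves coordinate zero alone. *)
Definition shifted_features (c : R) (w : Omega) : d.+1.-tuple (measurableTypeR R) :=
  [tuple X w 0 i + (if i == 0 :> nat then 0 else c) | i < d.+1].

Lemma measurable_label s : measurable [set w | y w = s].
Proof.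
have [my _ _ _] := XP.
by rewrite -[X in measurable X]setTI; exact: (my measurableT [set s]).
Qed.

Lemma measurable_shifted_features c : measurable_fun setT (shifted_features c).
Proof.
have [_ mX _ _] := XP.
apply/measurable_fun_tnthP => i.
rewrite (_ : _ \o _ = fun w => X w 0 i + (if i == 0 :> nat then 0 else c)).
  by apply: measurable_funD.
by apply/funext => w /=; rewrite tnth_mktuple.
Qed.

(** Preimages of boxes under the shift are boxes, on which the model prescribes the law; the shift
    merely moves the means of coordinates 1 to [d] to [m]. *)
Lemma shifted_features_law (s c m : R) (nu : probability (d.-tuple (measurableTypeR R)) R)
    (E : set (d.+1.-tuple (measurableTypeR R))) :
  s = 1 \/ s = -1 -> m = s * (alpha / Num.sqrt d%:R) + c ->
  iid (normal_prob m 1) nu -> measurable E ->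
  (P ([set w | y w = s] `&` shifted_features c @^-1` E) =
  (2^-1)%:E * (normal_prob s alpha^-1 \x nu) (@tuple_cons _ _ d @^-1` E))%E.
Proof.
move=> sP mE iidnu mEE.
have [_ mX _ law] := XP.
have h0 : 0 <= 2^-1 :> R by [].
apply: (cons_law (r := NngNum h0) iidnu (measurable_label s)
  (measurable_shifted_features c)) => // B mB.
pose sh (i : 'I_d.+1) : R := if i == 0 :> nat then 0 else c.
pose B' (i : 'I_d.+1) : set R := (fun x => x + sh i) @^-1` B i.
have mB' i : measurable (B' i).
  have msh : measurable_fun [set: R] (fun x : R => x + sh i).
    exact: measurable_funD.
  by rewrite -[X in measurable X]setTI; exact: (msh measurableT (B i) (mB i)).
rewrite [X in P X](_ : _ =
    [set w | y w = s] `&` \bigcap_i [set w | B' i (X w 0 i)]); last first.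
  congr (_ `&` _); apply/seteqP; split=> [w wB i _|w wB i].
    by have := wB i; rewrite tnth_mktuple.
  by rewrite tnth_mktuple; exact: wB.
rewrite law//; congr (_ * _)%E; rewrite big_ord_recl; congr (_ * _)%E.
  rewrite normal_prob_shift; last exact: mB.
    by rewrite /Dprime_mean /Dprime_sd /sh/= addr0.
  by rewrite /Dprime_sd/= gt_eqF// invr_gt0.
apply: eq_bigr => i _; rewrite normal_prob_shift; last exact: mB.
  by rewrite mE.
by rewrite /Dprime_sd/= oner_neq0.
Qed.

End model.

(** * The event that a permutation attack succeeds *)

Section rotation_event.
Context (R : realType) (n N : nat) (f : 'rV[R]_n -> R).
Implicit Types (t : n.-tuple (measurableTypeR R)) (s : R).

Definition rv_of_tuple t : 'rV[R]_n := \row_i tnth t i.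

Definition rt_error s : set (n.-tuple (measurableTypeR R)) :=
  [set t | exists2 x', S_RT N (rv_of_tuple t) x' & f x' <> s].

Lemma permute_rv_of_tuple p q t :
  permute_rV (rv_of_tuple (tuple_perm p t)) q = permute_rV (rv_of_tuple t) (q * p)%g.
Proof. by apply/rowP => i; rewrite !mxE tnth_mktuple permM. Qed.

(** The admissible permutations form a group: composing the attack with [p] or its inverse yields
    another admissible attack. *)
Lemma rt_error_perm s (p : 'S_n) : (forall i : 'I_n, (N <= i)%N -> p i = i) ->
  tuple_perm p @^-1` rt_error s = rt_error s.
Proof.
move=> pN; apply/seteqP; split=> t [_ [q qN <-] fs].
  exists (permute_rV (rv_of_tuple t) (q * p)%g).
    by exists (q * p)%g => // i Ni; rewrite permM qN// pN.
  by rewrite -permute_rv_of_tuple.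
exists (permute_rV (rv_of_tuple t) q) => //.
exists (q * p^-1)%g; last by rewrite permute_rv_of_tuple mulgKV.
by move=> i Ni; rewrite permM qN// -{1}(pN _ Ni) permK.
Qed.

(** A finite union, over the admissible permutations, of preimages of one of the two Borel decision
    regions of [f]. *)
Lemma measurable_rt_error s : classifier f -> s = 1 \/ s = -1 ->
  measurable (rt_error s).
Proof.
move=> [fpm mf] sP.
rewrite (_ : rt_error s = \bigcup_(q : 'S_n)
    (if `[< forall i : 'I_n, (N <= i)%N -> q i = i >]
     then [set t | f (permute_rV (rv_of_tuple t) q) <> s] else set0)).
  apply: countable_bigcupT_measurable => [|q]; first exact: countableP.
  case: ifP => // _.
  have mq : measurable [set t | f (permute_rV (rv_of_tuple t) q) = 1].
    apply: (measurable_borel_preimage (X := fun t => permute_rV (rv_of_tuple t) q) _ mf).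
    move=> i; rewrite (_ : (fun _ => _) = @tnth _ _ ^~ (q i)).
      exact: measurable_tnth.
    by apply/funext => t; rewrite !mxE.
  have fN t : f (permute_rV (rv_of_tuple t) q) <> 1 <->
      f (permute_rV (rv_of_tuple t) q) = -1.
    have [->|->] := fpm (permute_rV (rv_of_tuple t) q); split=> // /eqP.
    - by rewrite -subr_eq0 opprK (_ : 1 + 1 = 2%:R)// pnatr_eq0.
    - by move=> _ /esym/eqP; rewrite -subr_eq0 opprK (_ : 1 + 1 = 2%:R)// pnatr_eq0.
  case: sP => ->; first exact: measurableC.
  rewrite (_ : [set _ | _] = [set t | f (permute_rV (rv_of_tuple t) q) = 1])//.
  apply/seteqP; split=> t /=; rewrite -fN; first by move=> /contrapT.
  by move=> -> /(_ erefl).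
apply/seteqP; split=> [t [_ [q qN <-] fs]|t [q _]].
  by exists q => //; case: asboolP.
by case: asboolP => // qN fs; exists (permute_rV (rv_of_tuple t) q) => //; exists q.
Qed.

End rotation_event.

(** * The two adversaries and their success probabilities *)

Section attack.
Context (R : realType) (d N : nat) (alpha : R) (dO : measure_display).
Context (Omega : measurableType dO) (P : probability Omega R).
Context (y : Omega -> R) (X : Omega -> 'rV[R]_d.+1) (f : 'rV[R]_d.+1 -> R).
Hypotheses (XP : Dprime_model alpha P y X) (fP : classifier f).
Hypotheses (N_ge2 : (2 <= N)%N) (leNd : (N.-1 <= d)%N).
Hypothesis alpha_gt : (Num.sqrt 2)^-1 < alpha.

Let eta : R := alpha / Num.sqrt d%:R.
Let alpha_gt0 : 0 < alpha.
Proof. by apply: lt_trans alpha_gt; rewrite invr_gt0 sqrtr_gt0. Qed.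
Let d_gt0 : (0 < d)%N.
Proof. by apply: leq_trans leNd; rewrite -ltnS prednK// ltnW. Qed.
Let eta_gt0 : 0 < eta.
Proof. by rewrite divr_gt0// sqrtr_gt0 ltr0n. Qed.
Let eta_le : eta <= alpha.
Proof.
rewrite ler_pdivrMr ?sqrtr_gt0 ?ltr0n//; apply: ler_peMr; first exact: ltW.
by rewrite -[leLHS]sqrtr1 ler_wsqrtr ?ler1n.
Qed.

Definition rt_success s : set Omega :=
  [set w | y w = s] `&` shifted_features X 0 @^-1` rt_error N f s.

(** Under label [- s] the shift moves the means from [- s * eta] to [s * eta]. Outside the error set
    even the identity permutation leaves the classification at [s], which is then the wrong
    label. *)
Definition linf_success s : set Omega :=
  [set w | y w = - s] `&`
  shifted_features X (2 * s * eta) @^-1` (~` rt_error N f s).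

Let sgnN s : s = 1 \/ s = -1 :> R -> - s = 1 \/ - s = -1.
Proof. by case=> ->; rewrite ?opprK; [right|left]. Qed.

Lemma measurable_rt_success s : s = 1 \/ s = -1 -> measurable (rt_success s).
Proof.
move=> sP; apply: measurableI; first exact: measurable_label XP s.
rewrite -[X in measurable X]setTI.
by apply: (measurable_shifted_features XP 0) => //; exact: measurable_rt_error.
Qed.

Lemma measurable_linf_success s : s = 1 \/ s = -1 -> measurable (linf_success s).
Proof.
move=> sP; apply: measurableI; first exact: measurable_label XP (- s).
rewrite -[X in measurable X]setTI.
apply: (measurable_shifted_features XP (2 * s * eta)) => //.
by apply: measurableC; exact: measurable_rt_error.
Qed.

Lemma success_ge (V : R) s : s = 1 \/ s = -1 ->
  (forall m m' : R, `|m| = 1 -> `|m'| <= alpha ->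
    (\int[normal_prob m' 1]_x (normal_ratio m alpha^-1 m' 1 x ^+ 2)%:E <= V%:E)%E) ->
  ((2^-1 * (1 - (V + V + 1) / (2 * Num.sqrt N%:R)))%:E <=
    P (rt_success s) + P (linf_success s))%E.
Proof.
move=> sP VP.
have s1 : `|s| = 1 by case: sP => ->; rewrite ?normrN normr1.
have [nu iidnu] := @iid_exists _ _ R d (normal_prob (s * eta) 1).
have mE := measurable_rt_error N fP sP.
rewrite /rt_success (shifted_features_law alpha_gt0 XP sP _ iidnu mE) ?addr0//.
(* The shifted mean is [- s * eta + 2 * s * eta = s * eta], so both events involve the same [nu]. *)
rewrite /linf_success (shifted_features_law alpha_gt0 XP (sgnN sP) _ iidnu); last 2 first.
- by rewrite -/eta; ring.
- exact: measurableC.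
rewrite -muleDr// ?ge0_adde_def ?inE ?measure_ge0// EFinM lee_pmul2l//.
have ai0 : alpha^-1 != 0 by rewrite gt_eqF// invr_gt0.
have mP : `|s * eta| <= alpha by rewrite normrM s1 mul1r gtr0_norm.
have o0 := oner_neq0 R.
apply: (symmetric_test iidnu (g1 := normal_ratio s alpha^-1 (s * eta) 1)
  (g2 := normal_ratio (- s) alpha^-1 (s * eta) 1)) => //.
- exact: ltnW.
- by rewrite -(prednK (ltnW N_ge2)) ltnS.
- exact: measurable_normal_ratio.
- exact: measurable_normal_ratio.
- exact: normal_ratio_ge0.
- exact: normal_ratio_ge0.
- by move=> A mA; exact: normal_prob_density.
- by move=> A mA; exact: normal_prob_density.
- exact: VP.
- by apply: VP => //; rewrite normrN.
- exact: rt_error_perm.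
Qed.

Let label_disjoint (s : R) (A B : set Omega) :
  A `<=` [set w | y w = s] -> B `<=` [set w | y w = - s] -> s != 0 -> A `&` B = set0.
Proof.
move=> As Bs s0; apply/seteqP; split=> // w [/As /= ys /Bs /=]; rewrite ys.
by move=> /eqP; rewrite -subr_eq0 opprK -mulr2n mulrn_eq0/= (negbTE s0).
Qed.

(** The success events of the two labels are disjoint, measurable and contained in the risk event,
    so their total probability bounds its outer probability from below. *)
Lemma rt_risk_ge :
  (P (rt_success 1) + P (rt_success (-1)) <= adv_risk P y X f (S_RT N))%E.
Proof.
have p1 : 1 = 1 :> R \/ 1 = -1 :> R by left.
have m1 : -1 = 1 :> R \/ -1 = -1 :> R by right.
rewrite -measureU; [|exact: measurable_rt_success|exact: measurable_rt_success|]; last first.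
  by apply: (@label_disjoint 1) => [w []|w []|].
apply: outer_prob_ge; first by apply: measurableU; exact: measurable_rt_success.
have XE w : rv_of_tuple (shifted_features X 0 w) = X w.
  by apply/rowP => i; rewrite mxE tnth_mktuple if_same addr0.
by move=> w [] [/= -> [x']]; rewrite XE => ? ?; exists x'.
Qed.

Lemma linf_risk_ge :
  (P (linf_success 1) + P (linf_success (-1)) <=
   adv_risk P y X f (S_linf (2 * eta)))%E.
Proof.
have p1 : 1 = 1 :> R \/ 1 = -1 :> R by left.
have m1 : -1 = 1 :> R \/ -1 = -1 :> R by right.
rewrite -measureU; [|exact: measurable_linf_success|exact: measurable_linf_success|]; last first.
  by apply: (@label_disjoint (-1)) => [w []|w []|].
apply: outer_prob_ge; first by apply: measurableU; exact: measurable_linf_success.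
suff H s : s = 1 \/ s = -1 -> linf_success s `<=`
    [set w | exists x', S_linf (2 * eta) (X w) x' /\ f x' <> y w].
  by move=> w [] sw; [exact: (H 1)|exact: (H (-1))].
move=> sP w [/= -> /= nE].
exists (rv_of_tuple (shifted_features X (2 * s * eta) w)); split.
  exists (\row_(i < d.+1) (if i == 0 :> nat then 0 else 2 * s * eta)).
    rewrite /= /linf_norm; apply/bigmax_leP; split.
      by rewrite mulr_ge0 ?ltW.
    move=> i _; rewrite mxE; case: ifP => _; first by rewrite normr0 mulr_ge0 ?ltW.
    rewrite 2!normrM (gtr0_norm eta_gt0) ger0_norm//.
    by case: sP => ->; rewrite ?normrN normr1 mulr1.
  by apply/rowP => i; rewrite !mxE tnth_mktuple.
(* If the shifted point were classified correctly, as [- s], the identity permutation would put it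
   in the error set. *)
move=> fs; apply: nE; exists (rv_of_tuple (shifted_features X (2 * s * eta) w)).
  exists 1%g; first by move=> i _; rewrite perm1.
  by apply/rowP => i; rewrite mxE perm1.
rewrite fs => /esym/eqP; rewrite -subr_eq0 opprK -mulr2n mulrn_eq0/=.
by case: sP => ->; rewrite ?oppr_eq0 oner_eq0.
Qed.

End attack.

(** * Combination of both labels and both adversaries *)

Unset Implicit Arguments.

Theorem theorem2 (R : realType) (alpha : R) :
  (Num.sqrt 2)^-1 < alpha ->
  exists C : R,
    forall (N d : nat), (2 <= N)%N -> (N.-1 <= d)%N ->
    forall (dO : measure_display) (Omega : measurableType dO)
           (P : probability Omega R) (y : Omega -> R) (X : Omega -> 'rV[R]_d.+1),
    Dprime_model alpha P y X ->
    forall f : 'rV[R]_d.+1 -> R, classifier f ->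
    ((2^-1 - C / Num.sqrt N%:R)%:E <=
      avg_adv_risk P y X f
        (S_linf (2 * (alpha / Num.sqrt d%:R)))
        (S_RT N))%E.
Proof.
move=> ha; have [V VP] := normal_ratio2_bound ha.
(* Each label contributes half of [1 - (V + V + 1) / (2 * Num.sqrt N%:R)]; adding the two labels and
   averaging over the two adversaries gives the factor one quarter. *)
exists ((V + V + 1) / 4) => N d N2 Nd dO Omega P y X XP f fP.
have p1 : 1 = 1 :> R \/ 1 = -1 :> R by left.
have m1 : -1 = 1 :> R \/ -1 = -1 :> R by right.
have G1 := success_ge XP fP N2 Nd ha p1 VP.
have G2 := success_ge XP fP N2 Nd ha m1 VP.
have GR := rt_risk_ge N XP fP.
have GL := linf_risk_ge XP fP N2 Nd ha.
rewrite /avg_adv_risk.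
have sN : 0 < Num.sqrt (N%:R : R) by rewrite sqrtr_gt0 ltr0n ltnW.
rewrite (_ : 2^-1 - _ = 2^-1 * (2^-1 * (1 - (V + V + 1) / (2 * Num.sqrt N%:R)) +
  2^-1 * (1 - (V + V + 1) / (2 * Num.sqrt N%:R)))); last first.
  by field; rewrite gt_eqF.
rewrite EFinM lee_pmul2l// EFinD.
apply: (le_trans (leeD G1 G2)).
apply: le_trans (leeD GL GR).
(* Regroups the four success probabilities by adversary instead of by label. *)
by rewrite addeACA [leRHS]addeC.
Qed.
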